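(* Let $(w_1,w_2,d)\in\{(2,2,6),(4,2,8),(6,4,12)\}$ and put $C_{11}=\frac{4d}{w_1w_2}$, $C_{12}=\frac{2d}{w_1w_2}$, $C_{22}=0$. The Gauss–Manin Lie algebra, i.e. the complex Lie algebra (with the commutator bracket of $4\times 4$ complex matrices) generated by $$\mathfrak{g}_1=\begin{pmatrix}1&0&0&0\\0&0&0&0\\0&0&0&0\\0&0&0&-1\end{pmatrix},\quad \mathfrak{g}_2=\begin{pmatrix}0&0&0&0\\0&C_{12}&-C_{11}&0\\0&C_{22}&-C_{12}&0\\0&0&0&0\end{pmatrix},\quad \mathfrak{g}_3=\begin{pmatrix}0&0&0&0\\C_{11}&0&0&0\\C_{12}&0&0&0\\0&1&0&0\end{pmatrix},\quad \mathfrak{g}_4=\begin{pmatrix}0&0&0&0\\C_{12}&0&0&0\\C_{22}&0&0&0\\0&0&1&0\end{pmatrix},$$ $$\mathsf{A}_{\mathsf{R}_1}=\begin{pmatrix}0&1&0&0\\0&0&0&C_{11}\\0&0&0&C_{12}\\0&0&0&0\end{pmatrix},\quad \mathsf{A}_{\mathsf{R}_2}=\begin{pmatrix}0&0&1&0\\0&0&0&C_{12}\\0&0&0&C_{22}\\0&0&0&0\end{pmatrix},$$ is isomorphic to $\mathrm{sl}_2(\mathbb{C})\oplus\mathrm{sl}_2(\mathbb{C})$.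
   Context: Origin of the matrices. The three triples $(w_1,w_2,d)$ correspond to the K3 surfaces of degree $d$ in weighted projective space $\mathbb{P}(w_1,w_2,1,1)$ which are elliptically fibered with fibers of type $E_6,E_7,E_8$; the $C_{ab}$ are their intersection numbers. Let $$\Phi=\begin{pmatrix}0&0&-1\\0&(C_{ab})_{a,b=1,2}&0\\-1&0&0\end{pmatrix}$$ (blocks of size $1,2,1$). The matrices $\mathfrak{g}_1,\dots,\mathfrak{g}_4$ are a basis of the Lie algebra of the group $\mathsf{G}$ of matrices $\mathsf{g}\in GL(4,\mathbb{C})$ that are block lower triangular (blocks of size $1,2,1$) and satisfy $\mathsf{g}\Phi\mathsf{g}^{\mathrm{tr}}=\Phi$. The matrices $\mathsf{A}_{\mathsf{R}_1},\mathsf{A}_{\mathsf{R}_2}$ are the Gauss–Manin connection matrices of the modular vector fields $\mathsf{R}_1,\mathsf{R}_2$ on the moduli space $\mathsf{T}$ of mirror K3 surfaces enhanced with a basis $\alpha=(\alpha_1,\ldots,\alpha_4)^{\mathrm{tr}}$ of differential forms, compatible with the Hodge filtration and with intersection matrix $\Phi$, i.e. $\nabla_{\mathsf{R}_a}\alpha=\mathsf{A}_{\mathsf{R}_a}\alpha$. Vector fields are represented by their connection matrices. *)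

(* Defs.v *)
From HB Require Import structures.
From mathcomp Require Import all_boot all_order all_algebra.
From mathcomp Require Import ring.
From mathcomp Require Import boolp reals complex.

Set Implicit Arguments.
Unset Strict Implicit.
Unset Printing Implicit Defensive.

Import GRing.Theory.
Local Open Scope ring_scope.

HB.mixin Record Lmodule_isLieAlgebra (K : comNzRingType) L
    of GRing.Lmodule K L := {
  lie : L -> L -> L;
  lie_linearl : forall y : L, linear (fun x : L => lie x y);
  lie_linearr : forall x : L, linear (lie x);
  liexx : forall x : L, lie x x = 0;
  lie_jacobi : forall x y z : L,
    lie x (lie y z) + lie y (lie z x) + lie z (lie x y) = 0
}.

#[short(type="lieAlgType")]
HB.structure Definition LieAlgebra (K : comNzRingType) :=
  { L of GRing.Lmodule K L & Lmodule_isLieAlgebra K L }.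

Section MatrixLie.
Variables (K : comNzRingType) (n : nat).
Implicit Types A B D : 'M[K]_n.

Definition mxcomm A B : 'M[K]_n := A *m B - B *m A.

Fact mxcomm_linearl B : linear (mxcomm^~ B).
Proof.
move=> a A D; rewrite /mxcomm mulmxDl mulmxDr -scalemxAl -scalemxAr.
by rewrite scalerBr opprD addrACA.
Qed.

Fact mxcomm_linearr A : linear (mxcomm A).
Proof.
move=> a B D; rewrite /mxcomm mulmxDl mulmxDr -scalemxAl -scalemxAr.
by rewrite scalerBr opprD addrACA.
Qed.

Fact mxcommxx A : mxcomm A A = 0.
Proof. exact: subrr. Qed.

Fact mxcomm_jacobi A B D :
  mxcomm A (mxcomm B D) + mxcomm B (mxcomm D A) + mxcomm D (mxcomm A B) = 0.
Proof.
rewrite /mxcomm !mulmxBl !mulmxBr !mulmxA !opprB.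
by apply/matrixP => i j; rewrite !mxE; ring.
Qed.

HB.instance Definition _ := Lmodule_isLieAlgebra.Build K 'M[K]_n
  mxcomm_linearl mxcomm_linearr mxcommxx mxcomm_jacobi.
End MatrixLie.

Section ProdLie.
Variables (K : comNzRingType) (L1 L2 : lieAlgType K).

Definition prod_lie (x y : L1 * L2) : L1 * L2 :=
  (lie x.1 y.1, lie x.2 y.2).

Fact prod_lie_linearl y : linear (prod_lie^~ y).
Proof. by move=> a x z; congr pair; apply: lie_linearl. Qed.

Fact prod_lie_linearr x : linear (prod_lie x).
Proof. by move=> a y z; congr pair; apply: lie_linearr. Qed.

Fact prod_liexx x : prod_lie x x = 0.
Proof. by congr pair; apply: liexx. Qed.

Fact prod_lie_jacobi x y z :
  prod_lie x (prod_lie y z) + prod_lie y (prod_lie z x)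
    + prod_lie z (prod_lie x y) = 0.
Proof. by congr pair; apply: lie_jacobi. Qed.

HB.instance Definition _ := Lmodule_isLieAlgebra.Build K (L1 * L2)%type
  prod_lie_linearl prod_lie_linearr prod_liexx prod_lie_jacobi.
End ProdLie.

Section LieSubalgebra.
Variables (K : comNzRingType) (L : lieAlgType K).

Definition lie_closed (S : {pred L}) : Prop :=
  submod_closed S /\ {in S &, forall x y, lie x y \in S}.

Record lieSubalg := LieSubalg {
  lsub_pred :> {pred L};
  lsub_closed : lie_closed lsub_pred
}.

Variable U : lieSubalg.

Fact lsub_submod_closed : submod_closed (lsub_pred U).
Proof. by case: (lsub_closed U). Qed.

HB.instance Definition _ :=
  GRing.isSubmodClosed.Build K L (lsub_pred U) lsub_submod_closed.

Record lsub_of := LsubOf { lsub_val : L; lsub_valP : lsub_val \in lsub_pred U }.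

HB.instance Definition _ := [isSub for lsub_val].
HB.instance Definition _ := [Choice of lsub_of by <:].
HB.instance Definition _ := [SubChoice_isSubLmodule of lsub_of by <:].

Definition lsub_lie (x y : lsub_of) : lsub_of :=
  LsubOf ((lsub_closed U).2 _ _ (lsub_valP x) (lsub_valP y)).

Fact lsub_lie_linearl y : linear (lsub_lie^~ y).
Proof. by move=> a x z; apply: val_inj; rewrite linearP; apply: lie_linearl. Qed.

Fact lsub_lie_linearr x : linear (lsub_lie x).
Proof. by move=> a y z; apply: val_inj; rewrite linearP; apply: lie_linearr. Qed.

Fact lsub_liexx x : lsub_lie x x = 0.
Proof. by apply: val_inj; rewrite raddf0; apply: liexx. Qed.

Fact lsub_lie_jacobi x y z :
  lsub_lie x (lsub_lie y z) + lsub_lie y (lsub_lie z x)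
    + lsub_lie z (lsub_lie x y) = 0.
Proof. by apply: val_inj; rewrite !raddfD raddf0; apply: lie_jacobi. Qed.

HB.instance Definition _ := Lmodule_isLieAlgebra.Build K lsub_of
  lsub_lie_linearl lsub_lie_linearr lsub_liexx lsub_lie_jacobi.
End LieSubalgebra.

Section LieGenerated.
Variables (K : comNzRingType) (L : lieAlgType K) (X : seq L).

Definition lie_gen_pred : {pred L} :=
  [pred x | `[< forall U : lieSubalg L, {subset X <= U} -> x \in U >]].

Fact lie_gen_closed : lie_closed lie_gen_pred.
Proof.
split; first split.
- by apply/asboolP => U _; case: (lsub_submod_closed U).
- move=> a x y /asboolP xG /asboolP yG; apply/asboolP => U XU.
  by case: (lsub_submod_closed U) => _; apply; [exact: xG | exact: yG].
move=> x y /asboolP xG /asboolP yG; apply/asboolP => U XU.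
by case: (lsub_closed U) => _; apply; [exact: xG | exact: yG].
Qed.

Definition lie_gen : lieSubalg L := LieSubalg lie_gen_closed.
End LieGenerated.

Section SpecialLinear.
Variables (K : comNzRingType) (n : nat).

Definition sl_pred : {pred 'M[K]_n} := [pred A | \tr A == 0].

Fact sl_closed : lie_closed sl_pred.
Proof.
split; first split.
- by rewrite inE mxtrace0.
- move=> a A B; rewrite !inE => /eqP A0 /eqP B0.
  by rewrite mxtraceD mxtraceZ A0 B0 mulr0 addr0.
by move=> A B _ _; rewrite inE raddfB /= mxtrace_mulC subrr.
Qed.

Definition sl : lieSubalg 'M[K]_n := LieSubalg sl_closed.
End SpecialLinear.

Arguments sl K n : clear implicits.

Definition lie_isomorphic (K : comNzRingType) (L1 L2 : lieAlgType K) : Prop :=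
  exists2 f : {linear L1 -> L2},
    bijective f & {morph f : x y / lie x y >-> lie x y}.

Definition mx4 (K : pzRingType) (rows : seq (seq K)) : 'M[K]_4 :=
  \matrix_(i, j) nth 0 (nth [::] rows i) j.

(* With Phi the block matrix (0, 0, -1; 0, (C_ab), 0; -1, 0, 0), where
   (C_ab) = (C11, C12; C12, C22), the g_i span the Lie algebra of the group of
   block lower triangular g with g Phi g^T = Phi; AR1 and AR2 are the
   Gauss-Manin connection matrices of the modular vector fields R_1, R_2. *)
Section GaussManin.
Variables (K : fieldType) (C11 C12 C22 : K).

Definition g1 : 'M[K]_4 := mx4
  [:: [:: 1; 0; 0;  0];
      [:: 0; 0; 0;  0];
      [:: 0; 0; 0;  0];
      [:: 0; 0; 0; -1]].

Definition g2 : 'M[K]_4 := mx4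
  [:: [:: 0;   0;    0; 0];
      [:: 0; C12; -C11; 0];
      [:: 0; C22; -C12; 0];
      [:: 0;   0;    0; 0]].

Definition g3 : 'M[K]_4 := mx4
  [:: [::   0; 0; 0; 0];
      [:: C11; 0; 0; 0];
      [:: C12; 0; 0; 0];
      [::   0; 1; 0; 0]].

Definition g4 : 'M[K]_4 := mx4
  [:: [::   0; 0; 0; 0];
      [:: C12; 0; 0; 0];
      [:: C22; 0; 0; 0];
      [::   0; 0; 1; 0]].

Definition AR1 : 'M[K]_4 := mx4
  [:: [:: 0; 1; 0;   0];
      [:: 0; 0; 0; C11];
      [:: 0; 0; 0; C12];
      [:: 0; 0; 0;   0]].

Definition AR2 : 'M[K]_4 := mx4
  [:: [:: 0; 0; 1;   0];
      [:: 0; 0; 0; C12];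
      [:: 0; 0; 0; C22];
      [:: 0; 0; 0;   0]].

Definition gauss_manin : lieSubalg 'M[K]_4 :=
  lie_gen [:: g1; g2; g3; g4; AR1; AR2].
End GaussManin.

(* Main.v *)
Require Import Defs.
From HB Require Import structures.
From mathcomp Require Import all_boot all_order all_algebra.
From mathcomp Require Import ring.
From mathcomp Require Import boolp reals complex.

(** With [C22 = 0] and [C11 = 2 C12 = 2 c], the six generators form a basis of
    the orthogonal Lie algebra of a split quadratic form in four variables.
    The Cartan subalgebra spanned by [g1], [g2] has four root vectors, in two
    mutually commuting opposite pairs: [AR2], [g3 - g4] with
    [[AR2, g3 - g4] = c g1 + g2], and [AR1 - AR2], [g4] with
    [[AR1 - AR2, g4] = c g1 - g2]. Each pair spans a copy of [sl2]. *)

Import GRing.Theory.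
Local Open Scope ring_scope.

Section SplitOrthogonal.
Variables (K : fieldType) (c : K).
Hypotheses (two_neq0 : 2%:R != 0 :> K) (c_neq0 : c != 0).

Notation GM := (gauss_manin (2%:R * c) c 0).

Definition sl2_mx (h e f : K) : 'M[K]_2 :=
  \matrix_(i, j) nth 0 (nth [::] [:: [:: h; e]; [:: f; - h]] i) j.

Lemma sl2_mx_sl (h e f : K) : sl2_mx h e f \in sl K 2.
Proof.
by rewrite inE /mxtrace !big_ord_recl big_ord0 !mxE /= addr0 subrr.
Qed.

Lemma sl2P (A : 'M[K]_2) :
  A \in sl K 2 -> exists h e f, A = sl2_mx h e f.
Proof.
rewrite inE /mxtrace !big_ord_recl big_ord0 addr0 addrC addr_eq0 => /eqP trA.
exists (A 0 0), (A 0 1), (A 1 0); apply/matrixP => i j; rewrite mxE.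
case: i => [[|[|//]] ip]; case: j => [[|[|//]] jp] /=;
  rewrite -?trA; congr (A _ _); exact: val_inj.
Qed.

(** Coordinates [h], [e], [f] along [g1 + g2 / c], [AR2], [(g3 - g4) / c], and [k], [u], [v] along
    [g1 - g2 / c], [AR1 - AR2], [g4 / c]. Dividing by [c] turns each triple into a standard sl2
    triple. *)
Definition gm_mx (h e f k u v : K) : 'M[K]_4 := mx4
  [:: [:: h + k;     u;               e - u;           0];
      [:: f + v; h - k; - (2%:R * (h - k)); c * (e + u)];
      [::     f;     0;               k - h;       c * u];
      [::     0; f / c;         (v - f) / c;   - (h + k)]].

Definition gm_of_sl2 (A B : 'M[K]_2) : 'M[K]_4 :=
  gm_mx (A 0 0) (A 0 1) (A 1 0) (B 0 0) (B 0 1) (B 1 0).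

Lemma gm_of_sl2_mx (h e f k u v : K) :
  gm_of_sl2 (sl2_mx h e f) (sl2_mx k u v) = gm_mx h e f k u v.
Proof. by rewrite /gm_of_sl2 !mxE. Qed.

(** Reads the first triple of coordinates off the entries of [gm_mx]: the diagonal holds [h + k] and
    [h - k], whence the division by 2. The result has trace zero for every [M]. *)
Definition sl2_left (M : 'M[K]_4) : 'M[K]_2 :=
  sl2_mx ((M 0 0 + M 1 1) / 2%:R) (M 0 1 + M 0 2%:R) (M 2%:R 0).

Definition sl2_right (M : 'M[K]_4) : 'M[K]_2 :=
  sl2_mx ((M 0 0 - M 1 1) / 2%:R) (M 0 1) (M 1 0 - M 2%:R 0).

Ltac mx_entries :=
  apply/matrixP; do ![case=> [[|[|[|[|//]]]] ?] //];
  rewrite ?(mxE, big_ord_recl, big_ord0) /=.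

Lemma gm_of_sl2_linear (a : K) (A B A' B' : 'M[K]_2) :
  gm_of_sl2 (a *: A + A') (a *: B + B') =
  a *: gm_of_sl2 A B + gm_of_sl2 A' B'.
Proof. by mx_entries; ring. Qed.

Lemma sl2_mx_lie (h e f h' e' f' : K) :
  lie (sl2_mx h e f) (sl2_mx h' e' f') =
  sl2_mx (e * f' - e' * f) (2%:R * (h * e' - h' * e))
    (2%:R * (f * h' - f' * h)).
Proof. by rewrite /lie /= /mxcomm; mx_entries; ring. Qed.

Lemma gm_of_sl2_lie (A B A' B' : 'M[K]_2) :
  A \in sl K 2 -> B \in sl K 2 -> A' \in sl K 2 -> B' \in sl K 2 ->
  gm_of_sl2 (lie A A') (lie B B') = lie (gm_of_sl2 A B) (gm_of_sl2 A' B').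
Proof.
move=> /sl2P[h [e [f ->]]] /sl2P[k [u [v ->]]].
move=> /sl2P[h' [e' [f' ->]]] /sl2P[k' [u' [v' ->]]].
rewrite !sl2_mx_lie !gm_of_sl2_mx /lie /= /mxcomm.
by mx_entries; field.
Qed.

Lemma gm_of_sl2K (A B : 'M[K]_2) : A \in sl K 2 -> B \in sl K 2 ->
  sl2_left (gm_of_sl2 A B) = A /\ sl2_right (gm_of_sl2 A B) = B.
Proof.
move=> /sl2P[h [e [f ->]]] /sl2P[k [u [v ->]]].
by rewrite gm_of_sl2_mx; split; mx_entries; field.
Qed.

Lemma sl2_left_linear (a : K) (M N : 'M[K]_4) :
  sl2_left (a *: M + N) = a *: sl2_left M + sl2_left N.
Proof. by mx_entries; ring. Qed.

Lemma sl2_right_linear (a : K) (M N : 'M[K]_4) :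
  sl2_right (a *: M + N) = a *: sl2_right M + sl2_right N.
Proof. by mx_entries; ring. Qed.

Lemma gm_of_sl2E (A B : 'M[K]_2) :
  gm_of_sl2 A B =
    (A 0 0 + B 0 0) *: g1 K + ((A 0 0 - B 0 0) / c) *: g2 (2%:R * c) c 0
    + (A 1 0 / c) *: g3 (2%:R * c) c + ((B 1 0 - A 1 0) / c) *: g4 c 0
    + B 0 1 *: AR1 (2%:R * c) c + (A 0 1 - B 0 1) *: AR2 c 0.
Proof. by mx_entries; field. Qed.

Lemma gm_of_sl2_in (A B : 'M[K]_2) : gm_of_sl2 A B \in GM.
Proof.
apply/asboolP => U gU; rewrite gm_of_sl2E.
by rewrite !rpredD // rpredZ // gU // !inE eqxx ?orbT.
Qed.

(** The image of pairs of traceless matrices, cut out as a fixed-point set so that membership is an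
    equation. *)
Definition gm_of_sl2_image : {pred 'M[K]_4} :=
  [pred M | M == gm_of_sl2 (sl2_left M) (sl2_right M)].

Lemma gm_mx_image (h e f k u v : K) : gm_mx h e f k u v \in gm_of_sl2_image.
Proof.
rewrite inE -gm_of_sl2_mx; apply/eqP.
by have [-> ->] := gm_of_sl2K _ _ (sl2_mx_sl h e f) (sl2_mx_sl k u v).
Qed.

Lemma gm_of_sl2_image_closed : lie_closed gm_of_sl2_image.
Proof.
split; first split.
- suff -> : 0 = gm_mx 0 0 0 0 0 0 by apply: gm_mx_image.
  by mx_entries; ring.
- move=> a M N; rewrite !inE sl2_left_linear sl2_right_linear.
  by move=> /eqP {1}-> /eqP {1}->; rewrite gm_of_sl2_linear.
move=> M N; rewrite !inE => /eqP -> /eqP ->.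
by rewrite -gm_of_sl2_lie ?sl2_mx_sl //; apply: gm_mx_image.
Qed.

Lemma gm_generators_image :
  {subset [:: g1 K; g2 (2%:R * c) c 0; g3 (2%:R * c) c; g4 c 0;
              AR1 (2%:R * c) c; AR2 c 0] <= gm_of_sl2_image}.
Proof.
(* [g1] and [g2 / c] are the half sum and half difference of the two Cartan elements [g1 + g2 / c]
   and [g1 - g2 / c]. *)
have g1E : g1 K = gm_mx (1 / 2%:R) 0 0 (1 / 2%:R) 0 0 by mx_entries; field.
have g2E : g2 (2%:R * c) c 0 = gm_mx (c / 2%:R) 0 0 (- c / 2%:R) 0 0.
  by mx_entries; field.
have g3E : g3 (2%:R * c) c = gm_mx 0 0 c 0 0 c by mx_entries; field.
have g4E : g4 c 0 = gm_mx 0 0 0 0 0 c by mx_entries; field.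
have A1E : AR1 (2%:R * c) c = gm_mx 0 1 0 0 1 0 by mx_entries; field.
have A2E : AR2 c 0 = gm_mx 0 1 0 0 0 0 by mx_entries; field.
move=> X; rewrite !in_cons in_nil orbF g1E g2E g3E g4E A1E A2E.
by move=> /or4P[|||/or3P[]] /eqP ->; apply: gm_mx_image.
Qed.

(** The image is a Lie subalgebra containing the generators, so it contains [GM] by minimality. *)
Lemma sl2_leftrightK (M : 'M[K]_4) : M \in GM ->
  gm_of_sl2 (sl2_left M) (sl2_right M) = M.
Proof.
move=> /asboolP /(_ (LieSubalg gm_of_sl2_image_closed)) MU.
exact/esym/eqP/MU/gm_generators_image.
Qed.

Definition gm_to_sl2 (x : lsub_of GM) : lsub_of (sl K 2) * lsub_of (sl K 2) :=
  (LsubOf (sl2_mx_sl _ _ _ : sl2_left (val x) \in sl K 2),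
   LsubOf (sl2_mx_sl _ _ _ : sl2_right (val x) \in sl K 2)).

Lemma gm_to_sl2_linear : linear gm_to_sl2.
Proof.
move=> a x y; congr pair; apply: val_inj.
- exact: (sl2_left_linear a (val x) (val y)).
- exact: (sl2_right_linear a (val x) (val y)).
Qed.

HB.instance Definition _ :=
  GRing.isLinear.Build K (lsub_of GM) (lsub_of (sl K 2) * lsub_of (sl K 2))%type
    _ gm_to_sl2 gm_to_sl2_linear.

Definition gm_from_sl2 (z : lsub_of (sl K 2) * lsub_of (sl K 2)) : lsub_of GM :=
  LsubOf (gm_of_sl2_in (val z.1) (val z.2)).

Lemma gm_to_sl2K : cancel gm_to_sl2 gm_from_sl2.
Proof. by move=> x; apply: val_inj; apply: sl2_leftrightK (lsub_valP x). Qed.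

Lemma gm_from_sl2K : cancel gm_from_sl2 gm_to_sl2.
Proof.
move=> [[A slA] [B slB]]; have [AE BE] := gm_of_sl2K _ _ slA slB.
by congr pair; apply: val_inj.
Qed.

Lemma gm_from_sl2_lie : {morph gm_from_sl2 : y z / lie y z >-> lie y z}.
Proof.
move=> [y1 y2] [z1 z2]; apply: val_inj.
by apply: gm_of_sl2_lie; apply: lsub_valP.
Qed.

Lemma gauss_manin_isomorphic :
  lie_isomorphic (lsub_of GM) (lsub_of (sl K 2) * lsub_of (sl K 2))%type.
Proof.
exists gm_to_sl2; first exact: Bijective gm_to_sl2K gm_from_sl2K.
(* Brackets were checked for the inverse map, whose arguments have explicit coordinates; its
   injectivity transfers the result. *)
move=> x y; apply: (can_inj gm_from_sl2K).
by rewrite gm_from_sl2_lie !gm_to_sl2K.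
Qed.

End SplitOrthogonal.

Theorem theorem4p2 (R : realType) (w1 w2 d : nat)
    (hw : (w1, w2, d) \in [:: (2, 2, 6); (4, 2, 8); (6, 4, 12)]%N)
    (C11 C12 C22 : R[i])
    (hC11 : C11 = (4 * d)%:R / (w1 * w2)%:R)
    (hC12 : C12 = (2 * d)%:R / (w1 * w2)%:R)
    (hC22 : C22 = 0) :
  lie_isomorphic (lsub_of (gauss_manin C11 C12 C22))
    (lsub_of (sl R[i] 2) * lsub_of (sl R[i] 2))%type.
Proof.
have -> : C11 = 2%:R * C12 by rewrite hC11 hC12 mulrA -natrM mulnA.
rewrite hC22; apply: gauss_manin_isomorphic.
  by rewrite Num.Theory.pnatr_eq0.
(* The denominator matters too: since [0^-1 = 0], a zero weight would make [C12] vanish. *)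
have [w_neq0 d_neq0] : (w1 * w2 != 0)%N /\ (2 * d != 0)%N.
  by move: hw; rewrite !inE => /or3P[] /eqP[] -> -> ->.
by rewrite hC12 mulf_neq0 ?invr_eq0 ?Num.Theory.pnatr_eq0.
Qed.
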